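(* Let $m \ge 1$ be odd and $n \ge 4$ be even. The honeycomb toroidal graph $\mathrm{HTG}(m,n,3)$ is 2-spanning cyclable if and only if one of the following holds: (i) $m=1$, $n \equiv 0 \pmod 4$ and $n > 6$; (ii) $m \geq 5$ and $n = 6$; (iii) $m \geq 3$ and $n \geq 8$.
   Context: For integers $m\ge 1$, $\ell\ge 0$ and $n\ge 4$ with $n$ even and $m-\ell$ even, the honeycomb toroidal graph $\mathrm{HTG}(m,n,\ell)$ is the simple graph with vertex set $\{u_{i,j}: 0\le i\le m-1,\ 0\le j\le n-1\}$ (first subscript computed modulo $m$, second modulo $n$) whose edge set is the set of the following unordered pairs: $\{u_{i,j},u_{i,j+1}\}$ for all $i,j$ (vertical edges); $\{u_{i,j},u_{i+1,j}\}$ for all $0\le i\le m-2$ with $i+j$ odd (flat edges); and $\{u_{m-1,j},u_{0,j+\ell}\}$ for all $j$ having the same parity as $m$ (and $\ell$) (jump edges). (Repeated pairs give a single edge.) A 2-factor of a graph is a spanning subgraph in which every vertex has valency 2. A graph $X$ is 2-spanning cyclable if for every pair of distinct vertices $u,v$ of $X$ there is a 2-factor of $X$ consisting of exactly two cycles such that $u$ and $v$ lie in different cycles. *)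

(* Defs.v *)
From mathcomp Require Import all_boot.

Set Implicit Arguments.
Unset Strict Implicit.
Unset Printing Implicit Defensive.

(** The vertex u_{i,j} is the pair [(i, j)]. [htg_arc] gives one orientation of
    each edge: vertical, flat, jump. *)
Definition htg_arc (m n l : nat) : rel ('I_m * 'I_n) := fun u v =>
  [|| (v.1 == u.1) && (v.2 == (u.2 + 1) %% n :> nat),
      [&& v.1 == u.1 + 1 :> nat, odd (u.1 + u.2) & v.2 == u.2]
    | [&& u.1 + 1 == m, v.1 == 0 :> nat, odd u.2 == odd m
        & v.2 == (u.2 + l) %% n :> nat]].

Definition htg (m n l : nat) : rel ('I_m * 'I_n) := fun u v =>
  htg_arc l u v || htg_arc l v u.

Lemma htg_sym (m n l : nat) : symmetric (@htg m n l).
Proof. by move=> u v; rewrite /htg orbC. Qed.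

Lemma htg_irr (m n l : nat) : 4 <= n -> ~~ odd n -> odd m = odd l ->
  irreflexive (@htg m n l).
Proof.
move=> n_ge4 n_even eq_ml [i j]; rewrite /htg orbb /htg_arc /= eqxx.
have jE : j = j %% n :> nat by rewrite modn_small.
rewrite {1}jE -{1}[val j]addn0 eqn_modDl mod0n modn_small; last first.
  exact: leq_trans n_ge4.
rewrite /= addn1 ltn_eqF //=; apply/negbTE/negP => /and4P[/eqP im /eqP i0 _].
move/eqP/(congr1 odd); rewrite odd_mod ?(negbTE n_even) // oddD.
by rewrite -eq_ml -im i0; case: (odd j).
Qed.

(** A spanning subgraph is given by its adjacency relation [f]. *)
Definition two_factor (T : finType) (e f : rel T) : Prop :=
  [/\ symmetric f, subrel f e & forall x, #|[set y | f x y]| = 2].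

(** Adjacency in the cycle graph running through the sequence [c]. *)
Definition cycle_adj (T : finType) (c : seq T) : rel T := fun x y =>
  [&& x \in c, y \in c & (next c x == y) || (next c y == x)].

(** [f] is the union of the vertex-disjoint cycles [c1] and [c2]; they span the
    graph as soon as [f] is a 2-factor. *)
Definition consists_of_two_cycles (T : finType) (f : rel T) (c1 c2 : seq T) :
    Prop :=
  [/\ 3 <= size c1, 3 <= size c2, uniq (c1 ++ c2)
    & forall x y, f x y = cycle_adj c1 x y || cycle_adj c2 x y].

Definition two_spanning_cyclable (T : finType) (e : rel T) : Prop :=
  forall u v : T, u != v ->
  exists (f : rel T) (c1 c2 : seq T),
    [/\ two_factor e f, consists_of_two_cycles f c1 c2, u \in c1 & v \in c2].

(* Main.v *)
Require Import Defs.
From mathcomp Require Import all_boot zify.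

(** The graph is vertex-transitive, so one vertex [x] may be fixed. Suppose that
    some hexagon has a Hamiltonian complement. The three hexagons around [x] meet
    only in [x], hence every other vertex is avoided by one of them, and images of
    a single 2-factor (a hexagon and the rest) separate all pairs. Explicit
    Hamilton cycles of the complement exist for [m >= 5], [n >= 6] and for
    [m = 3], [n >= 8]. For [m = 1] the hexagon is replaced by a 4-cycle, which
    works for all pairs but the ends of one kind of vertical edge; these are
    separated by two cycles of length [n / 2] when 4 divides [n].

    Conversely, colour the vertices by the cycle containing them. If [m = 1] and
    the ends of a vertical edge starting at an odd level have different colours,
    then 2-regularity propagates this to the next such edge with the colours
    exchanged, which is impossible after [n / 2] steps if [n / 2] is odd. If
    [n = 4], the ends of a flat edge are not separated: in each of their two
    columns the two odd levels have the same colour, so the other flat edge between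
    these columns is absent as well, both columns are cycles, and a third column is
    left over. The graph HTG(3,6,3) has 18 vertices and is settled by a search. *)

Set Implicit Arguments.
Unset Strict Implicit.
Unset Printing Implicit Defensive.

(** * Cycles, 2-factors and automorphisms of finite graphs *)

Section CycleGraphs.
Variable T : finType.
Implicit Types (c : seq T) (e f : rel T) (u v : T).

Lemma cycle_sub_closed c (P : pred T) x : uniq c -> x \in c -> P x ->
  (forall y, y \in c -> P y -> P (next c y)) ->
  forall y, y \in c -> P y.
Proof.
move=> Uc xc Px closP y.
rewrite -(fconnect_cycle (cycle_next Uc) xc) => /iter_findex <-.
suff iterP k : (iter k (next c) x \in c) && P (iter k (next c) x).
  by case/andP: (iterP (findex (next c) x y)).
by elim: k => [|k /andP[kc Pk]] /=; rewrite ?xc // mem_next kc closP.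
Qed.

(** Otherwise [x] and [next c x] would form a set closed under [next c], hence the whole cycle. *)
Lemma next_neq_prev c x : uniq c -> 2 < size c -> x \in c -> next c x != prev c x.
Proof.
move=> Uc c_gt2 xc; apply: contraTneq c_gt2 => eq_np; rewrite -leqNgt.
apply: (@uniq_leq_size _ _ [:: x; next c x] Uc).
apply: (@cycle_sub_closed c [in [:: x; next c x]] x) => // [|y _].
  exact: mem_head.
rewrite !inE => /orP[/eqP->|/eqP->]; first by rewrite eqxx orbT.
by rewrite eq_np next_prev // eqxx.
Qed.

Lemma cycle_adj_sym c : symmetric (cycle_adj c).
Proof. by move=> x y; rewrite /cycle_adj andbCA orbC. Qed.

Lemma cycle_adjE c x y : uniq c ->
  cycle_adj c x y = (x \in c) && (y \in [:: next c x; prev c x]).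
Proof.
move=> Uc; rewrite /cycle_adj; case xc: (x \in c) => //=; rewrite !inE.
rewrite (eq_sym y) -(can2_eq (prev_next Uc) (next_prev Uc)).
case yc: (y \in c) => //=; apply/esym/negbTE/norP; split.
  by apply: contraFneq yc => <-; rewrite mem_next.
by apply: contraFneq yc => eq_x; rewrite -mem_next eq_x xc.
Qed.

(** A 2-factor given by its two cycles alone; the relation [f] is rebuilt from them in
    [separated_two_factor]. *)
Definition disjoint_cycle_cover e c1 c2 :=
  [/\ cycle e c1 /\ cycle e c2, 2 < size c1, 2 < size c2, uniq (c1 ++ c2)
    & forall x, x \in c1 ++ c2].

Definition separated e u v := exists c1 c2,
  [/\ disjoint_cycle_cover e c1 c2, u \in c1 & v \in c2].

(** A covering list whose length is the number of vertices has no repetition. Explicit constructions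
    thus need only a count and a covering argument, never a check of disjointness. *)
Lemma disjoint_cycle_coverI e c1 c2 : cycle e c1 -> cycle e c2 ->
  2 < size c1 -> 2 < size c2 -> size c1 + size c2 = #|T| ->
  (forall x, x \in c1 ++ c2) -> disjoint_cycle_cover e c1 c2.
Proof.
move=> ec1 ec2 sz1 sz2 szT cov; split=> //.
by apply: (leq_size_uniq (enum_uniq T)); rewrite // size_cat szT cardE.
Qed.

Lemma card_cycle_adj c x : uniq c -> 2 < size c -> x \in c ->
  #|[set y | cycle_adj c x y]| = 2.
Proof.
move=> Uc c_gt2 xc.
have ->: [set y | cycle_adj c x y] = [set next c x; prev c x].
  by apply/setP=> y; rewrite !inE cycle_adjE // xc !inE.
by rewrite cards2 next_neq_prev.
Qed.

Lemma cycle_adj_sub e c : symmetric e -> cycle e c -> uniq c ->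
  subrel (cycle_adj c) e.
Proof.
move=> e_sym ec Uc x y /and3P[xc yc /orP[/eqP<-|/eqP<-]].
  exact: next_cycle.
by rewrite e_sym next_cycle.
Qed.

Lemma separated_two_factor e u v : symmetric e -> separated e u v ->
  exists (f : rel T) (c1 c2 : seq T),
    [/\ two_factor e f, consists_of_two_cycles f c1 c2, u \in c1 & v \in c2].
Proof.
move=> e_sym [c1 [c2 [[[ec1 ec2] sz1 sz2 Uc cov] uc vc]]].
exists (fun x y => cycle_adj c1 x y || cycle_adj c2 x y), c1, c2; split=> //.
move: (Uc); rewrite cat_uniq => /and3P[U1 /hasPn disj U2]; split.
- by move=> x y; rewrite !(cycle_adj_sym _ x).
- by move=> x y /orP[]; apply: cycle_adj_sub.
move=> x; have [x1|] := boolP (x \in c1).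
  rewrite -(card_cycle_adj U1 sz1 x1); apply: eq_card => y; rewrite !inE.
  by rewrite [cycle_adj c2 _ _]cycle_adjE // (contraTF (disj x)) ?x1 ?orbF.
have:= cov x; rewrite mem_cat => /orP[-> //|x2 /negbTE x1].
rewrite -(card_cycle_adj U2 sz2 x2); apply: eq_card => y; rewrite !inE.
by rewrite [cycle_adj c1 _ _]cycle_adjE // x1.
Qed.

Definition automorphism e (phi : T -> T) :=
  injective phi /\ forall x y, e (phi x) (phi y) = e x y.

(** By finiteness, an injective map that preserves edges permutes the set of edges, so it reflects
    them too. *)
Lemma automorphismI e phi : injective phi ->
  (forall x y, e x y -> e (phi x) (phi y)) -> automorphism e phi.
Proof.
move=> inj_phi hom_phi; split=> // x y; apply/idP/idP; last exact: hom_phi.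
pose E := [set p : T * T | e p.1 p.2]; pose Phi p := (phi p.1, phi p.2).
have inj_Phi : injective Phi by move=> [a b] [c d] [/inj_phi-> /inj_phi->].
have sub_E : Phi @: E \subset E.
  by apply/subsetP=> _ /imsetP[p ep ->]; rewrite !inE in ep *; apply: hom_phi.
have /eqP E_E : Phi @: E == E by rewrite eqEcard sub_E (card_imset _ inj_Phi) leqnn.
move=> e_xy; have: Phi (x, y) \in Phi @: E by rewrite E_E inE.
by case/imsetP=> p ep /inj_Phi def_p; rewrite -def_p inE in ep.
Qed.

Lemma automorphism_comp e phi psi :
  automorphism e phi -> automorphism e psi -> automorphism e (phi \o psi).
Proof.
by case=> injf homf [injg homg]; split=> [|x y] /=; [exact: inj_comp | rewrite homf].
Qed.

Lemma automorphism_iter e phi k : automorphism e phi -> automorphism e (iter k phi).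
Proof.
by move=> aut; elim: k => [|k IHk]; [split | exact: automorphism_comp].
Qed.

Lemma automorphism_inv e phi :
  automorphism e phi -> exists2 psi, automorphism e psi & cancel phi psi.
Proof.
case=> inj_phi hom_phi; exists (finv phi); last exact: finv_f.
split=> [|x y]; first exact: finv_inj.
by rewrite -hom_phi !f_finv.
Qed.

Lemma separated_aut e phi u v : automorphism e phi ->
  separated e u v -> separated e (phi u) (phi v).
Proof.
case=> inj_phi hom_phi [c1 [c2 [[[ec1 ec2] sz1 sz2 Uc cov] uc vc]]].
exists (map phi c1), (map phi c2); split; try exact: map_f.
split; rewrite ?size_map -?map_cat ?map_inj_uniq //.
  by rewrite !cycle_map !(@eq_cycle _ (relpre phi e) e).
by move=> x; rewrite -(f_finv inj_phi x) map_f.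
Qed.

Lemma separated_aut_inv e phi u v : automorphism e phi ->
  separated e (phi u) (phi v) -> separated e u v.
Proof.
move=> /automorphism_inv[psi aut_psi phiK] /(separated_aut aut_psi).
by rewrite !phiK.
Qed.

Lemma two_spanning_cyclable_transitive e x0 : symmetric e ->
  (forall x, exists2 phi, automorphism e phi & phi x0 = x) ->
  (forall v, v != x0 -> separated e x0 v) -> two_spanning_cyclable e.
Proof.
move=> e_sym trans sep u v neq_uv; apply: separated_two_factor => //.
have [phi aut_phi phi_x0] := trans u.
have [psi aut_psi phiK] := automorphism_inv aut_phi.
apply: (separated_aut_inv aut_psi); rewrite -phi_x0 phiK; apply: sep.
have psiK : cancel psi phi by apply/(bij_can_sym (injF_bij aut_phi.1)).
by apply: contraNneq neq_uv => def_x0; rewrite -phi_x0 -def_x0 psiK.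
Qed.

(** Valency 2 gives [x] a neighbour, and every edge of [f] has its ends on one of the cycles. *)
Lemma two_cycles_mem e f c1 c2 x : two_factor e f ->
  consists_of_two_cycles f c1 c2 -> x \in c1 ++ c2.
Proof.
case=> _ _ deg2 [_ _ _ fE]; have: 0 < #|[set y | f x y]| by rewrite deg2.
case/card_gt0P=> y; rewrite inE fE mem_cat.
by case/orP=> /andP[->]; rewrite ?orbT.
Qed.

Lemma two_cycles_invariant f c1 c2 x y : consists_of_two_cycles f c1 c2 ->
  f x y -> (x \in c1) = (y \in c1).
Proof.
case=> _ _; rewrite cat_uniq => /and3P[_ /hasPn disj _] fE; rewrite fE.
case/orP=> /and3P[xc yc _]; first by rewrite xc yc.
by rewrite (negbTE (disj _ xc)) (negbTE (disj _ yc)).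
Qed.

(* Each cycle is connected, so an [f]-closed set meeting it contains it. *)
Lemma two_cycles_closed f c1 c2 (P Q : pred T) u v :
  consists_of_two_cycles f c1 c2 -> u \in c1 -> v \in c2 -> P u -> Q v ->
  (forall x y, f x y -> P x -> P y) -> (forall x y, f x y -> Q x -> Q y) ->
  forall x, x \in c1 ++ c2 -> P x || Q x.
Proof.
case=> _ _; rewrite cat_uniq => /and3P[U1 _ U2] fE uc vc Pu Qv cloP cloQ x.
have adj_next c y : y \in c -> cycle_adj c y (next c y).
  by move=> yc; rewrite /cycle_adj mem_next yc eqxx.
rewrite mem_cat => /orP[xc|xc]; apply/orP; [left | right].
  apply: (cycle_sub_closed U1 uc Pu _ xc) => y yc.
  by apply: cloP; rewrite fE adj_next.
apply: (cycle_sub_closed U2 vc Qv _ xc) => y yc.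
by apply: cloQ; rewrite fE adj_next ?orbT.
Qed.

End CycleGraphs.

(** * Coordinates on the honeycomb toroidal graph and its vertex-transitivity *)

Section HoneycombToroidal.
Variables m n : nat.
Hypotheses (m_odd : odd m.+1) (n_even : ~~ odd n.+1).
Local Notation T := ('I_m.+1 * 'I_n.+1)%type.
Local Notation e := (@htg m.+1 n.+1 3).

(** The level [j] is any natural number, read modulo [n.+1]; the column [i] is not reduced and must
    be at most [m]. *)
Definition vtx i j : T := (inord i, inord (j %% n.+1)).

Lemma vtx2K i j : (vtx i j).2 = j %% n.+1 :> nat.
Proof. by rewrite inordK // ltn_pmod. Qed.

Lemma vtx1K i j : i <= m -> (vtx i j).1 = i :> nat.
Proof. by move=> le_im; rewrite inordK. Qed.

Lemma vtxK (u : T) : vtx u.1 u.2 = u.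
Proof. by case: u => i j; rewrite /vtx /= modn_small // !inord_val. Qed.

Lemma fst_le (u : T) : u.1 <= m.
Proof. by rewrite -ltnS ltn_ord. Qed.

Lemma eq_vtx i j j' : j = j' %[mod n.+1] -> vtx i j = vtx i j'.
Proof. by rewrite /vtx => ->. Qed.

Lemma vtx_inj i j i' j' : i <= m -> i' <= m ->
  vtx i j = vtx i' j' -> i = i' /\ j = j' %[mod n.+1].
Proof.
move=> le_im le_i'm eq_v; split; first by rewrite -(vtx1K j le_im) eq_v vtx1K.
by rewrite -(vtx2K i) eq_v vtx2K.
Qed.

Lemma odd_modn_even j : odd (j %% n.+1) = odd j.
Proof. by rewrite odd_mod //; apply: negbTE. Qed.

Lemma vtx_vertical i j : e (vtx i j) (vtx i j.+1).
Proof.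
by rewrite /htg /htg_arc !vtx2K eqxx modnDml addn1 eqxx.
Qed.

Lemma vtx_flat i j : i < m -> odd (i + j) -> e (vtx i j) (vtx i.+1 j).
Proof.
move=> lt_im odd_ij; apply/orP; left; apply/or3P; apply: Or32.
by rewrite !vtx1K ?(ltnW lt_im) // vtx2K oddD odd_modn_even -oddD odd_ij addn1 !eqxx.
Qed.

Lemma vtx_jump j : odd j -> e (vtx m j) (vtx 0 (j + 3)).
Proof.
move=> odd_j; apply/orP; left; apply/or3P; apply: Or33.
by rewrite !vtx1K // !vtx2K modnDml addn1 odd_modn_even odd_j m_odd !eqxx.
Qed.

Lemma htg_arcP u v : htg_arc 3 u v ->
  exists i j, u = vtx i j /\
  [\/ i <= m /\ v = vtx i j.+1,
      [/\ i < m, odd (i + j) & v = vtx i.+1 j]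
    | [/\ i = m, odd j & v = vtx 0 (j + 3)]].
Proof.
move=> arc; exists u.1, u.2; split; first by rewrite vtxK.
case/or3P: arc => [/andP[/eqP v1 /eqP v2]|/and3P[/eqP v1 odd_u /eqP v2]|].
- apply: Or31; rewrite -ltnS ltn_ord -(vtxK v) v1 v2 addn1;
  by split=> //; apply: eq_vtx; rewrite modn_mod.
- apply: Or32; rewrite -(vtxK v) v1 v2 addn1; split=> //.
  by have := ltn_ord v.1; lia.
case/and4P=> /eqP u1 /eqP v1 odd_u /eqP v2; apply: Or33.
split; [lia | by rewrite (eqP odd_u) | rewrite -(vtxK v) v1 v2].
by apply: eq_vtx; rewrite modn_mod.
Qed.

Lemma htg_hom (phi : T -> T) :
  (forall i j, i <= m -> e (phi (vtx i j)) (phi (vtx i j.+1))) ->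
  (forall i j, i < m -> odd (i + j) -> e (phi (vtx i j)) (phi (vtx i.+1 j))) ->
  (forall j, odd j -> e (phi (vtx m j)) (phi (vtx 0 (j + 3)))) ->
  forall u v, e u v -> e (phi u) (phi v).
Proof.
move=> homV homF homJ u v.
wlog: u v / htg_arc 3 u v => [hom_arc /orP[] uv|/htg_arcP[i [j [-> def_v]]] _].
- by apply: hom_arc; rewrite /htg ?uv.
- by rewrite htg_sym; apply: hom_arc; rewrite /htg ?uv.
by case: def_v => [[? ->]|[? ? ->]|[-> ? ->]]; auto.
Qed.

(** [shift2] and [shift_diag] preserve the parity of [i + j]; [flip], a half-turn, changes it, as
    [m] is even and [n] odd. Past the last column, the 4 is one level up plus the jump by 3. *)
Definition shift2 (u : T) : T := vtx u.1 (u.2 + 2).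
Definition shift_diag (u : T) : T :=
  if u.1 < m then vtx u.1.+1 u.2.+1 else vtx 0 (u.2 + 4).
Definition flip (u : T) : T := (rev_ord u.1, rev_ord u.2).

Lemma shift2E i j : i <= m -> shift2 (vtx i j) = vtx i (j + 2).
Proof. by move=> ?; rewrite /shift2 vtx1K // vtx2K; apply: eq_vtx; rewrite modnDml. Qed.

Lemma shift_diagE i j : i < m -> shift_diag (vtx i j) = vtx i.+1 j.+1.
Proof.
move=> lt_im; rewrite /shift_diag vtx1K ?(ltnW lt_im) // vtx2K lt_im.
by apply: eq_vtx; rewrite -addn1 modnDml addn1.
Qed.

Lemma shift_diag_last j : shift_diag (vtx m j) = vtx 0 (j + 4).
Proof.
by rewrite /shift_diag vtx1K // vtx2K ltnn; apply: eq_vtx; rewrite modnDml.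
Qed.

Lemma flipE i j : i <= m -> flip (vtx i j) = vtx (m - i) (n - j %% n.+1).
Proof.
move=> le_im; rewrite /flip -[LHS]vtxK /=.
by rewrite vtx1K // vtx2K ?subSS.
Qed.

Lemma shift2_aut : automorphism e shift2.
Proof.
apply: automorphismI.
  move=> u v; rewrite -(vtxK u) -(vtxK v) !shift2E ?fst_le //.
  case/vtx_inj; rewrite ?fst_le // => -> /eqP; rewrite eqn_modDr => /eqP.
  exact: eq_vtx.
apply: htg_hom => [i j le_im|i j lt_im odd_ij|j odd_j].
- by rewrite !shift2E // addSn vtx_vertical.
- by rewrite !shift2E ?(ltnW lt_im) // vtx_flat // addnA oddD odd_ij.
by rewrite !shift2E // addnAC vtx_jump // oddD odd_j.
Qed.

Lemma shift_diag_aut : automorphism e shift_diag.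
Proof.
apply: automorphismI.
  move=> u v; rewrite -(vtxK u) -(vtxK v).
  case: (ltngtP u.1 m) (fst_le u) => // [lt_um|->] _;
    case: (ltngtP v.1 m) (fst_le v) => // [lt_vm|->] _;
    rewrite ?shift_diag_last ?shift_diagE // => /vtx_inj[] //.
  2: by move=> _ /eqP; rewrite eqn_modDr => /eqP; apply: eq_vtx.
  move=> [->] /eqP; rewrite -(addn1 u.2) -(addn1 v.2) eqn_modDr => /eqP.
  exact: eq_vtx.
apply: htg_hom => [i j|i j lt_im odd_ij|j odd_j].
- rewrite leq_eqVlt => /predU1P[->|lt_im].
    by rewrite !shift_diag_last addSn vtx_vertical.
  by rewrite !shift_diagE // vtx_vertical.
- rewrite shift_diagE //; case: (ltngtP i.+1 m) lt_im => // [lt_i1m|eq_i1m] _.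
    by rewrite shift_diagE // vtx_flat // addSn addnS /= negbK.
  by rewrite eq_i1m shift_diag_last -addSnnS vtx_jump //; lia.
rewrite shift_diag_last; case: (ltngtP 0 m) => // [m_gt0|m0].
  by rewrite shift_diagE // -addnS vtx_flat //; lia.
(* With a single column, column 0 is also the last one, so both ends of the jump are raised by 4. *)
have vtx_m0 k : vtx 0 k = vtx m k by congr (inord _, _).
rewrite [vtx 0 (j + 3)]vtx_m0 shift_diag_last addnAC [X in e X]vtx_m0.
by apply: vtx_jump; rewrite oddD odd_j.
Qed.

(** Reversing both coordinates reverses the orientation of every edge, whence the uses of
    [htg_sym]. *)
Lemma flip_aut : automorphism e flip.
Proof.
apply: automorphismI.
  by apply: inv_inj => -[i j]; rewrite /flip !rev_ordK.
have n_sub j : n - j %% n.+1 = (n - j.+1 %% n.+1).+1 %[mod n.+1].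
  have := ltn_pmod j (ltn0Sn n); rewrite -[j.+1]addn1 -modnDml.
  set k := j %% _; rewrite ltnS leq_eqVlt => /predU1P[->|lt_kn].
    by rewrite addn1 modnn subn0 subnn modnn mod0n.
  by rewrite [(k + 1) %% _]modn_small ?addn1 // -subSn.
have n_subD j k : n - j %% n.+1 = (n - (j + k) %% n.+1) + k %[mod n.+1].
  elim: k => [|k IHk]; first by rewrite !addn0.
  by rewrite IHk -[in LHS]modnDml n_sub modnDml addSnnS [j + k.+1]addnS.
have odd_sub j : odd (n - j %% n.+1) = ~~ odd j.
  rewrite oddB -?[_ <= n]ltnS ?ltn_pmod // odd_modn_even.
  by move: n_even => /=; rewrite negbK => ->.
apply: htg_hom => [i j le_im|i j lt_im odd_ij|j odd_j].
- by rewrite !flipE // htg_sym (eq_vtx _ (n_sub j)) vtx_vertical.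
- rewrite !flipE ?(ltnW lt_im) // htg_sym -(subnSK lt_im).
  by rewrite vtx_flat // ?oddD ?odd_sub; lia.
rewrite !flipE // subnn subn0 htg_sym (eq_vtx _ (n_subD j 3)) vtx_jump //.
by rewrite odd_sub oddD odd_j.
Qed.

(** The two shifts carry [vtx 0 1] to every vertex with [i + j] odd, and [flip] exchanges the two
    parity classes. *)
Lemma htg_transitive u : exists2 phi, automorphism e phi & phi (vtx 0 1) = u.
Proof.
have trans_odd i j : i <= m -> odd (i + j) ->
    exists2 phi, automorphism e phi & phi (vtx 0 1) = vtx i j.
  elim: i j => [|i IHi] j le_im odd_ij.
    exists (iter j./2 shift2); first exact/automorphism_iter/shift2_aut.
    have shift2k k : iter k shift2 (vtx 0 1) = vtx 0 (1 + k * 2).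
      by elim: k => //= k ->; rewrite shift2E //; congr vtx; lia.
    by rewrite shift2k muln2 -[in RHS](odd_double_half j) odd_ij.
  (* Modulo [n.+1], [j + n] is the level just below [j]. *)
  have [||phi aut_phi phi_x0] := IHi (j + n); [exact: ltnW | by lia |].
  exists (shift_diag \o phi); first exact/automorphism_comp/aut_phi/shift_diag_aut.
  by rewrite /= phi_x0 shift_diagE // -addnS; apply: eq_vtx; rewrite modnDr.
have le_um := fst_le u; have le_un : u.2 <= n by rewrite -ltnS.
case odd_u: (odd (u.1 + u.2)).
  by have [phi] := trans_odd _ _ le_um odd_u; rewrite vtxK; exists phi.
have [|phi aut_phi phi_x0] := trans_odd (m - u.1) (n - u.2) (leq_subr _ _).
  rewrite oddD !oddB //; move: m_odd n_even odd_u; rewrite /= oddD.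
  by do 4!case: (odd _).
exists (flip \o phi); first exact/automorphism_comp/aut_phi/flip_aut.
by rewrite /= phi_x0 flipE ?leq_subr // modn_small ?ltnS ?leq_subr // !subKn // vtxK.
Qed.

End HoneycombToroidal.

(** * Walks with named ends, the pieces of explicit cycles *)

Section Walks.
Variables (T : eqType) (e : rel T).
Hypothesis e_sym : symmetric e.
Implicit Types (x y : T) (s : seq T).

(** Both ends are parameters, so that pieces can be joined and reversed without computing first and
    last elements. *)
Definition walk x y s :=
  if s is z :: s' then [&& z == x, path e z s' & last z s' == y] else false.

Lemma walk1 x : walk x x [:: x].
Proof. by rewrite /= !eqxx. Qed.

Lemma walk_cat x y x' y' s s' : walk x y s -> walk x' y' s' -> e y x' ->
  walk x y' (s ++ s').
Proof.
case: s s' => [|z s] [|z' s'] //= /and3P[/eqP-> zs /eqP last_s].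
case/and3P=> [/eqP-> zs' /eqP last_s'] e_yx'.
by rewrite eqxx cat_path zs last_cat /= last_s e_yx' zs' last_s' eqxx.
Qed.

Lemma walk_cons x y y' s : walk y y' s -> e x y -> walk x y' (x :: s).
Proof. exact: (walk_cat (walk1 x)). Qed.

Lemma walk_rcons x y y' s : walk x y s -> e y y' -> walk x y' (rcons s y').
Proof. by rewrite -cats1 => sW; apply: walk_cat (walk1 y'). Qed.

Lemma walk_rev x y s : walk x y s -> walk y x (rev s).
Proof.
elim: s x => [|z s IHs] x //=; case: s IHs => [|z' s] IHs /=.
  by rewrite /rev /= andbC.
case/and3P=> /eqP-> /andP[e_xz' zs] last_s; rewrite rev_cons.
apply: (walk_rcons (y := z')); last by rewrite e_sym.
by apply: IHs; rewrite /= eqxx zs.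
Qed.

Lemma walk_cycle x y s : walk x y s -> e y x -> cycle e s.
Proof.
case: s => //= z s /and3P[/eqP-> zs /eqP last_s] e_yx.
by rewrite rcons_path zs last_s.
Qed.

End Walks.

Definition column i a b : seq (nat * nat) := [seq (i, j) | j <- iota a (b.+1 - a)].

Lemma mem_column i a b p : (p \in column i a b) = (p.1 == i) && (a <= p.2 <= b).
Proof.
apply/mapP/idP => [[j + ->]|/andP[/eqP<- ab]].
  by rewrite mem_iota eqxx /=; lia.
by exists p.2; [rewrite mem_iota; lia | case: (p)].
Qed.

Lemma size_column i a b : size (column i a b) = b.+1 - a.
Proof. by rewrite size_map size_iota. Qed.

Lemma column_walk (e : rel (nat * nat)) i a b :
  (forall j, e (i, j) (i, j.+1)) -> a <= b -> walk e (i, a) (i, b) (column i a b).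
Proof.
move=> e_vert le_ab; rewrite -(subnK le_ab) addnC /column -addnS addKn.
move: (b - a) {le_ab} => k; elim: k a => [|k IHk] a; first by rewrite addn0 walk1.
by rewrite addnS -addSn; apply: (walk_cons (IHk a.+1)).
Qed.


(** * The hexagon criterion *)

Section Families.
Variables m n : nat.
Hypotheses (m_odd : odd m.+1) (n_even : ~~ odd n.+1).
Local Notation T := ('I_m.+1 * 'I_n.+1)%type.
Local Notation e := (@htg m.+1 n.+1 3).
Local Notation vtx := (@vtx m n).

(** Any [n.+1] consecutive levels represent a column. Coverings are checked in a window adapted to
    the levels that a cycle uses there. *)
Lemma vtx_window a (u : T) : exists2 j, a <= j < a + n.+1 & vtx u.1 j = u.
Proof.
exists (a + (u.2 + (n.+1 - a %% n.+1)) %% n.+1).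
  by rewrite leq_addr ltn_add2l ltn_pmod.
rewrite -[RHS]vtxK; apply: eq_vtx.
rewrite modnDmr addnCA -modnDmr -(modnDml a) subnKC ?modnn ?addn0 ?modn_mod //.
exact/ltnW/ltn_pmod.
Qed.

Definition hexagon := [:: vtx 0 1; vtx 0 2; vtx 0 3; vtx 1 3; vtx 1 2; vtx 1 1].

Lemma hexagon_cycle : 0 < m -> cycle e hexagon.
Proof.
move=> m_gt0; have eV i j : e (vtx i j.+1) (vtx i j).
  by rewrite htg_sym vtx_vertical.
have eF : e (vtx 1 1) (vtx 0 1) by rewrite htg_sym vtx_flat.
by rewrite /= !vtx_vertical !eV eF vtx_flat.
Qed.

Lemma vtx_hexagon i j : i < 2 -> 0 < j < 4 -> vtx i j \in hexagon.
Proof.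
by case: i j => [|[|i]] [|[|[|[|j]]]] // _ _; rewrite !inE eqxx ?orbT.
Qed.

Lemma mem_hexagon u : 0 < m -> 4 < n -> u \in hexagon -> (u.1 < 2) && (0 < u.2 < 4).
Proof.
move=> m_gt0 n_gt4.
have vtxE i j : i < 2 -> 0 < j < 4 ->
    ((vtx i j).1 < 2) && (0 < (vtx i j).2 < 4).
  by move=> lt_i2 j14; rewrite vtx1K ?vtx2K ?modn_small //; lia.
by rewrite !inE => /or4P[|||/or3P[]] /eqP->; apply: vtxE.
Qed.

(* The hexagons that are the images of [hexagon] under the inverses of the
   identity, [shift2] and [shift_diag] meet in the single vertex [vtx 0 1]. *)
Lemma hexagon_cyclable c2 : 1 < m -> 4 < n ->
  cycle e c2 -> size c2 = m.+1 * n.+1 - 6 -> (forall u, u \in hexagon ++ c2) ->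
  two_spanning_cyclable e.
Proof.
move=> m_gt1 n_gt4 cycle_c2 size_c2 cov.
have m_gt0 : 0 < m by exact: ltnW.
have mn_gt : 18 <= m.+1 * n.+1 by rewrite (@leq_mul 3 6).
have cover : disjoint_cycle_cover e hexagon c2.
  apply: disjoint_cycle_coverI => //; rewrite ?hexagon_cycle // size_c2; first by lia.
  by rewrite card_prod !card_ord /=; lia.
have sepH u v : u \in hexagon -> v \notin hexagon -> separated e u v.
  move=> uH /negPf vH; exists hexagon, c2; split=> //.
  by have:= cov v; rewrite mem_cat vH.
apply: (@two_spanning_cyclable_transitive _ _ (vtx 0 1)).
- exact: htg_sym.
- exact: htg_transitive.
move=> v neq_v; case vH: (v \in hexagon); last first.
  by apply: sepH; rewrite ?vH // mem_head.
case v2H: (shift2 v \in hexagon); last first.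
  apply: (separated_aut_inv (shift2_aut m_odd n_even)); apply: sepH; rewrite ?v2H //.
  by rewrite shift2E // !inE eqxx !orbT.
apply: (separated_aut_inv (shift_diag_aut m_odd n_even)); apply: sepH.
  by rewrite shift_diagE // !inE eqxx !orbT.
apply: contraNN neq_v => /(mem_hexagon m_gt0 n_gt4).
move/(mem_hexagon m_gt0 n_gt4): v2H; move/(mem_hexagon m_gt0 n_gt4): vH.
rewrite -(vtxK v) shift2E ?fst_le // !(vtx1K _ _ (fst_le v)) !vtx2K.
move: (v.1 : nat) (v.2 : nat) (fst_le v) (ltn_ord v.2) => i j le_im lt_jn.
rewrite [j %% _]modn_small // => /andP[lt_i2 j14].
rewrite [(j + 2) %% _]modn_small; last by lia.
(* In column 0 the level must be 1, which gives [vtx 0 1]; from column 1, [shift_diag] leads to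
   column 2, off the hexagon. *)
case: i le_im lt_i2 => [|[|i]] le_im _ // /andP[_ j2] ; first by have ->: j = 1 by lia.
by rewrite shift_diagE // vtx1K.
Qed.

End Families.

(** * Hamilton cycles of the hexagon complement for at least five columns *)

(* Two strands, on the levels [n .. n+3] and [n+4 .. 2n], run through the columns
   from 3 to [2k+3] and are joined by a turn through the columns 1 and 2. Levels
   are read modulo [n+1]. *)
Fixpoint snake n k : seq (nat * nat) :=
  if k is k'.+1 then
    rev (column (k'.*2 + 5) n (n + 3)) ++ column (k'.*2 + 4) n (n + 3) ++
    snake n k' ++
    rev (column (k'.*2 + 4) (n + 4) n.*2) ++ column (k'.*2 + 5) (n + 4) n.*2
  else
    rev (column 3 n (n + 3)) ++ rev (column 2 4 n) ++ column 1 4 n.+1 ++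
    column 2 n.+1 (n + 4) ++ column 3 (n + 4) n.*2.

Lemma size_snake n k : 4 < n -> size (snake n k) = n * 3 + k.*2 * n.+1.
Proof.
move=> n_gt4; elim: k => [|k IHk] /=;
  rewrite !size_cat ?IHk !(size_rev, size_column); nia.
Qed.

(** Columns 2 to [k.*2 + 3] are filled; column 1 lacks exactly the levels 1, 2, 3 of the hexagon. *)
Lemma mem_snake n k i j : 4 < n -> ((i, j) \in snake n k) =
  [|| [&& 3 <= i, i <= k.*2 + 3, n <= j & j <= n.*2],
      (i == 1) && (4 <= j <= n.+1) | (i == 2) && (4 <= j <= n + 4)].
Proof.
move=> n_gt4; elim: k => [|k IHk] /=;
  rewrite !mem_cat ?IHk !(mem_rev, mem_column) /=; lia.
Qed.

Section FiveColumns.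
Variables n k : nat.
Hypotheses (n_even : ~~ odd n.+1) (n_gt4 : 4 < n).
Local Notation m := (k.*2 + 4).
Local Notation e := (@htg m.+1 n.+1 3).
Let lift (p : nat * nat) := @vtx m n p.1 p.2.
Let e' : rel (nat * nat) := relpre lift e.

Let e'_sym : symmetric e'. Proof. by move=> p q; apply: htg_sym. Qed.

Let m_odd : odd m.+1. Proof. by rewrite /= addnC /= odd_double. Qed.

Let e'_vert i j : e' (i, j) (i, j.+1). Proof. exact: vtx_vertical. Qed.

Let e'_flat i j : i < m -> odd (i + j) -> e' (i, j) (i.+1, j).
Proof. exact: vtx_flat. Qed.

Let up i a b : a <= b -> walk e' (i, a) (i, b) (column i a b).
Proof. by move=> le_ab; apply: column_walk => // j; apply: e'_vert. Qed.

Let down i a b : a <= b -> walk e' (i, b) (i, a) (rev (column i a b)).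
Proof. by move=> le_ab; apply/walk_rev/up. Qed.

Lemma snake_walk l : l <= k ->
  walk e' (l.*2 + 3, n + 3) (l.*2 + 3, n.*2) (snake n l).
Proof.
elim: l => [|l IHl] lt_lk /=.
  apply: walk_cat (down 3 _) _ _; first by lia.
    apply: walk_cat (down 2 _) _ _; first by lia.
      apply: walk_cat (up 1 _) _ _; first by lia.
        apply: walk_cat (up 2 _) (up 3 _) _; try lia.
        by apply: e'_flat; lia.
      by apply: e'_flat; lia.
    by rewrite e'_sym; apply: e'_flat; lia.
  by rewrite e'_sym; apply: e'_flat; lia.
have l5 : l.+1.*2 + 3 = l.*2 + 5 by lia.
rewrite l5; apply: walk_cat (down _ _) _ _; first by lia.
  apply: walk_cat (up _ _) _ _; first by lia.
    apply: walk_cat (IHl _) _ _; first by lia.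
      apply: walk_cat (down _ _) (up _ _) _; try lia.
      by rewrite [l.*2 + 5]addnS; apply: e'_flat; lia.
    by rewrite [l.*2 + 4]addnS; apply: e'_flat; lia.
  by rewrite e'_sym [l.*2 + 4]addnS; apply: e'_flat; lia.
by rewrite e'_sym [l.*2 + 5]addnS; apply: e'_flat; lia.
Qed.

(** The part of column 0 outside the hexagon, and the last column cut into two pieces around the
    snake; two jump edges join these columns. *)
Definition snake_cycle : seq (nat * nat) :=
  column 0 (n + 5) (n.*2 + 2) ++ rev (column m (n + 3) n.*2.-1) ++ snake n k ++
  column m n.*2 (n.*2 + 3).

Lemma snake_cycleP : cycle e' snake_cycle.
Proof.
have e'_jump j j' : odd j -> j + 3 = j' %[mod n.+1] -> e' (m, j) (0, j').
  by move=> odd_j eq_j; rewrite /e' /lift /= -(eq_vtx _ _ eq_j) vtx_jump.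
apply: (@walk_cycle _ _ (0, n + 5) (m, n.*2 + 3)); last first.
  apply: e'_jump; first by lia.
  by rewrite (_ : _ + 3 = n + 5 + n.+1) ?modnDr; lia.
apply: walk_cat (up 0 _) _ _; first by lia.
  apply: walk_cat (down m _) _ _; first by lia.
    apply: walk_cat (snake_walk _) (up m _) _ => //; first by lia.
    by rewrite [m]addnS; apply: e'_flat; lia.
  by rewrite e'_sym [m]addnS; apply: e'_flat; lia.
rewrite e'_sym; apply: e'_jump; first by lia.
by congr (_ %% _); lia.
Qed.

Lemma cyclable_five_columns : two_spanning_cyclable e.
Proof.
apply: (hexagon_cyclable m_odd n_even (c2 := map lift snake_cycle)) => //.
- by lia.
- by rewrite cycle_map snake_cycleP.
- by rewrite size_map !size_cat size_rev !size_column size_snake //; nia.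
move=> u; rewrite mem_cat.
(* The first level of the window in which the cycle, together with the hexagon, runs through column
   [i]. In column 0 the hexagon appears at [n + 2], [n + 3], [n + 4]. *)
pose a i := if i == 0 then n + 2 else if i == 1 then 1 else if i == 2 then 4
  else if i < m then n else n + 3.
have [j + <-] := vtx_window (a u.1) u; rewrite {}/a.
move: (u.1 : nat) (fst_le u) => i le_im j_win.
case hex_ij: ((i == 0) && (j < n + 5) || (i == 1) && (j < 4)).
  case/orP: hex_ij => /andP[/eqP def_i lt_j]; rewrite {}def_i /= in j_win *.
    rewrite (eq_vtx _ _ (_ : j = j - n.+1 %[mod n.+1])) ?vtx_hexagon //; first by lia.
    by rewrite -[in LHS](@subnK n.+1 j) ?modnDr //; lia.
  by rewrite vtx_hexagon //; lia.
apply/orP; right; apply/mapP; exists (i, j) => //.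
rewrite !mem_cat mem_rev !mem_column mem_snake //=.
by move: j_win hex_ij; do 4?case: ifP; lia.
Qed.

End FiveColumns.

(** * Hamilton cycles of the hexagon complement for three columns *)

(* Each step of the recursion prolongs both ends of the path by one 6-cycle
   [{y, y+1} x {0, 1, 2}], in which the two strands exchange their columns, whence
   the reversal. *)
Fixpoint braid k : seq (nat * nat) :=
  if k is k'.+1 then
    let y := k'.*2 + 5 in
    [:: (2, y.+1); (1, y); (1, y.+1); (0, y)] ++ rev (braid k') ++
    [:: (2, y); (0, y.+1)]
  else [:: (2, 4); (2, 3); (0, 4)].

Lemma size_braid k : size (braid k) = k * 6 + 3.
Proof. by elim: k => //= k IHk; rewrite size_cat size_rev IHk /=; lia. Qed.

Lemma mem_braid_cap k : {subset [:: (2, 4); (2, 3); (0, 4)] <= braid k}.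
Proof.
elim: k => [|k IHk] p // /IHk pk.
by rewrite /= !(inE, mem_cat) mem_rev pk !orbT.
Qed.

Lemma mem_braid k i j : i < 3 -> 5 <= j <= k.*2 + 4 -> (i, j) \in braid k.
Proof.
move=> lt_i3; elim: k => [|k IHk] j_range; first by lia.
rewrite /= !(inE, mem_cat) mem_rev; case: (leqP j (k.*2 + 4)) => [le_j|lt_j].
  by rewrite IHk ?orbT; lia.
have [-> | ->] : j = k.*2 + 5 \/ j = (k.*2 + 5).+1 by lia.
  by case: i lt_i3 {IHk} => [|[|[|i]]] // _; rewrite !xpair_eqE !eqxx ?orbT.
by case: i lt_i3 {IHk} => [|[|[|i]]] // _; rewrite !xpair_eqE !eqxx ?orbT.
Qed.

Section ThreeColumns.
Variable k : nat.
Local Notation w := (k.*2 + 4).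
Local Notation n := w.+3.
Local Notation e := (@htg 3 n.+1 3).
(* The second coordinate is [i + j] instead of [j]; it is well defined modulo
   [n.+1] even though the jump edges shift [j] by 3. *)
Let lift (p : nat * nat) := @vtx 2 n p.1 (p.2 + (n.+1 - p.1)).
Let e' : rel (nat * nat) := relpre lift e.

Let n_even : ~~ odd n.+1. Proof. by lia. Qed.

Let e'_sym : symmetric e'. Proof. by move=> p q; apply: htg_sym. Qed.

Let e'_up i y : e' (i, y) (i, y.+1). Proof. exact: vtx_vertical. Qed.

Let e'_down i y : e' (i, y.+1) (i, y). Proof. by rewrite e'_sym e'_up. Qed.

(** In the skew coordinates flat and jump edges have the same form, so the three columns play the
    same role. *)
Let e'_diag i y : i < 3 -> odd y -> e' (i, y) (i.+1 %% 3, y.+1).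
Proof.
rewrite leq_eqVlt => /predU1P[[->] | lt_i2] odd_y; rewrite /e' /lift /=.
  have eq_y : y + (n.+1 - 2) + 3 = y.+1 + (n.+1 - 0) %[mod n.+1].
    by congr (_ %% _); lia.
  by rewrite -(eq_vtx _ _ eq_y) (@vtx_jump 2) //; lia.
rewrite modn_small //.
have ->: y.+1 + (n.+1 - i.+1) = y + (n.+1 - i) by lia.
by apply: (@vtx_flat 2 n n_even) => //; lia.
Qed.

Let e'_anti i y : i < 3 -> odd y -> e' (i.+1 %% 3, y.+1) (i, y).
Proof. by move=> lt_i3 odd_y; rewrite e'_sym e'_diag. Qed.

Let lift_mod i y : lift (i, y + n.+1) = lift (i, y).
Proof. by apply: eq_vtx; rewrite /= addnAC modnDr. Qed.

Lemma braid_walk l : walk e' (2, l.*2 + 4) (0, l.*2 + 4) (braid l).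
Proof.
elim: l => [|l IHl]; first by rewrite /= e'_down (@e'_diag 2).
have -> : l.+1.*2 + 4 = (l.*2 + 5).+1 by lia.
have odd_y : odd (l.*2 + 5) by lia.
apply: walk_cat (_ : walk _ _ (0, l.*2 + 5) _)
  (walk_cat (walk_rev e'_sym IHl) (_ : walk _ (2, l.*2 + 5) _ _) _) _.
- by rewrite /= (@e'_anti 1) // e'_up (@e'_anti 0) // !eqxx.
- by rewrite /= (@e'_diag 2) // !eqxx.
- by rewrite [_ + 5]addnS e'_up.
by rewrite [_ + 5]addnS e'_down.
Qed.

(** The hexagon is now [(0, y)] for [y] from 1 to 3 and [(1, y)] for [y] from 2 to 4. The braid
    fills the rows 5 to [w] and takes [(2, 3)], [(2, 4)], [(0, 4)]; the closing arc takes the top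
    four rows and, across the seam, [(2, 1)], [(2, 2)], [(1, 1)]. *)
Definition braid_cycle : seq (nat * nat) :=
  [:: (0, w.+4); (2, w.+3); (2, w.+4); (2, 1); (2, 2); (1, 1); (1, w.+4);
      (1, w.+3); (1, w.+2); (1, w.+1); (2, w.+2); (2, w.+1)] ++ braid k ++
  [:: (0, w.+1); (0, w.+2); (0, w.+3)].

Lemma braid_cycleP : cycle e' braid_cycle.
Proof.
have e'_top i : e' (i, w.+4) (i, 1).
  by rewrite /e' /= (lift_mod i 0 : lift (i, w.+4) = _); apply: (e'_up i 0).
have odd_w : odd w.+1 by lia.
apply: (@walk_cycle _ _ (0, w.+4) (0, w.+3)); last exact: e'_up.
apply: walk_cat (_ : walk _ _ (2, w.+1) _)
  (walk_cat (braid_walk k) (_ : walk _ (0, w.+1) _ _) _) _.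
- rewrite /= (@e'_anti 2) //= ?negbK // e'_up e'_top e'_up (@e'_anti 1) //.
  by rewrite [e' (1, 1) _]e'_sym e'_top !e'_down (@e'_diag 1) // !eqxx.
- by rewrite /= !e'_up !eqxx.
- exact: e'_up.
exact: e'_down.
Qed.

Lemma cyclable_three_columns : two_spanning_cyclable e.
Proof.
apply: (@hexagon_cyclable 2 n _ n_even (map lift braid_cycle)) => //.
- by lia.
- by rewrite cycle_map braid_cycleP.
- by rewrite size_map /= size_cat size_braid /=; lia.
move=> u; rewrite mem_cat.
(* In this window [y = i + j - n.+1] runs from 1 to [n.+1]. *)
have [j + <-] := vtx_window (n.+2 - u.1) u.
move: (u.1 : nat) (fst_le u) => i le_im j_win.
have [y y_win ->] : exists2 y, 0 < y <= n.+1 & vtx 2 n i j = lift (i, y).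
  by exists (i + j - n.+1); [lia | rewrite /lift /=; congr vtx; lia].
case hex_ij: ((i < 2) && (0 < y - i < 4)).
  have eq_y : y + (n.+1 - i) = y - i %[mod n.+1].
    by rewrite -[RHS]modnDr; congr (_ %% _); lia.
  by rewrite /lift /= (eq_vtx _ _ eq_y); case/andP: hex_ij => *; rewrite vtx_hexagon.
apply/orP; right; apply/map_f; rewrite !mem_cat.
case: (boolP (5 <= y <= w)) => [y_mid|y_out]; first by rewrite mem_braid ?orbT.
case: ((i, y) \in _) / (boolP ((i, y) \in [:: (2, 4); (2, 3); (0, 4)])).
  by move/(mem_braid_cap k) ->; rewrite orbT.
rewrite !(inE, xpair_eqE).
by case: i le_im hex_ij {j_win} => [|[|[|i]]] //= _; lia.
Qed.

End ThreeColumns.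

(** * One column: a 4-cycle with its complement, and two cycles of equal length *)

(** A path from [a] to [a + 1] through the levels [a] to [a + 4k + 1]: it leaves by the jump from
    [a] to [a + 3] and returns by the jump between [a + 5] and [a + 2]. *)
Fixpoint ladder k a : seq nat :=
  if k is k'.+1 then [:: a; a + 3] ++ ladder k' (a + 4) ++ [:: a + 2; a + 1]
  else [:: a; a + 1].

Lemma size_ladder k a : size (ladder k a) = k * 4 + 2.
Proof. by elim: k a => //= k IHk a; rewrite size_cat IHk /=; lia. Qed.

Lemma mem_ladder k a j : a <= j < a + k * 4 + 2 -> j \in ladder k a.
Proof.
elim: k a => [|k IHk] a j_range /=; first by rewrite !inE; lia.
rewrite !(inE, mem_cat); case: (boolP (a + 4 <= j)) => [le_j|lt_j].
  by rewrite IHk ?orbT //; lia.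
by lia.
Qed.

(** Jumps alternate with single vertical steps, so only the residues of [a] and [a + 3] modulo 4 are
    visited. *)
Fixpoint rail k a : seq nat :=
  if k is k'.+1 then [:: a, a + 3 & rail k' (a + 4)] else [:: a; a + 3].

Lemma size_rail k a : size (rail k a) = k * 2 + 2.
Proof. by elim: k a => //= k IHk a; rewrite IHk; lia. Qed.

Lemma mem_rail k a j : j <= k ->
  (a + j * 4 \in rail k a) && (a + j * 4 + 3 \in rail k a).
Proof.
elim: k a j => [|k IHk] a [|j] //= le_jk; rewrite !inE ?addn0 ?eqxx ?orbT //.
by have /andP[] := IHk (a + 4) j le_jk; rewrite mulSn addnA => -> ->; rewrite !orbT.
Qed.

Section OneColumn.
Variable k : nat.
Local Notation n := (k * 4 + 7).
Local Notation e := (@htg 1 n.+1 3).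
Let lift (j : nat) := @vtx 0 n 0 j.
Let e' : rel nat := relpre lift e.

Let n_even : ~~ odd n.+1. Proof. by lia. Qed.

Let e'_sym : symmetric e'. Proof. by move=> p q; apply: htg_sym. Qed.

Let e'_up j : e' j j.+1. Proof. exact: vtx_vertical. Qed.

Let e'_down j : e' j.+1 j. Proof. by rewrite e'_sym. Qed.

Let e'_jump j : odd j -> e' j (j + 3). Proof. exact: vtx_jump. Qed.

Let lift_mod j : lift (j + n.+1) = lift j.
Proof. by apply: eq_vtx; rewrite modnDr. Qed.

Lemma ladder_walk l a : odd a -> walk e' a (a + 1) (ladder l a).
Proof.
elim: l a => [|l IHl] a odd_a; first by rewrite /= addn1 e'_up !eqxx.
apply: (@walk_cat _ _ _ (a + 3)).
- by rewrite /= e'_jump // !eqxx.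
- apply: walk_cat (IHl (a + 4) _) (_ : walk _ (a + 2) _ _) _; first by lia.
    by rewrite /= addn2 addn1 e'_down !eqxx.
  by rewrite e'_sym (_ : a + 4 + 1 = a + 2 + 3) ?e'_jump; lia.
by rewrite [a + 4]addnS.
Qed.

Lemma rail_walk l a : odd a -> walk e' a (a + l * 4 + 3) (rail l a).
Proof.
elim: l a => [|l IHl] a odd_a; first by rewrite /= addn0 e'_jump // !eqxx.
apply: (walk_cons (y := a + 3)); last exact: e'_jump.
rewrite mulSn addnA; apply: walk_cons (IHl (a + 4) _) _; first by lia.
by rewrite [a + 4]addnS.
Qed.

Lemma lift_surj a u : exists2 j, a <= j < a + n.+1 & lift j = u.
Proof.
have [j ? <-] := vtx_window a u; exists j => //.
by rewrite [u.1]ord1.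
Qed.

(** The jumps from 1 to 4 and from 5 to 8 close the two cycles. *)
Lemma ladder_cover :
  disjoint_cycle_cover e (map lift [:: 1; 2; 3; 4])
    (map lift [:: 5, 6 & ladder k 7]).
Proof.
apply: disjoint_cycle_coverI; rewrite ?cycle_map ?size_map //.
- apply: (@walk_cycle _ e' 1 4); last by rewrite e'_sym (@e'_jump 1).
  by rewrite /= !e'_up.
- apply: (@walk_cycle _ e' 5 8); last by rewrite e'_sym (@e'_jump 5).
  apply: walk_cons (e'_up 5); apply: walk_cons (e'_up 6).
  exact: ladder_walk.
- by rewrite /= size_ladder; lia.
- by rewrite card_prod !card_ord /= size_ladder; lia.
move=> u; have [j j_win <-] := lift_surj 1 u.
rewrite -map_cat map_f // mem_cat !inE.
case: (boolP (7 <= j)) => [le7j|]; last by lia.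
by rewrite mem_ladder ?orbT //; lia.
Qed.

(** Each rail closes up by a vertical edge because 4 divides the number of levels; the starts 1 and
    3 give complementary residues. *)
Lemma rail_cover :
  disjoint_cycle_cover e (map lift (rail k.+1 1)) (map lift (rail k.+1 3)).
Proof.
apply: disjoint_cycle_coverI; rewrite ?cycle_map ?size_map ?size_rail //.
- apply: walk_cycle (rail_walk k.+1 (isT : odd 1)) _.
  rewrite /e' /= -(lift_mod 1) (_ : 1 + n.+1 = (1 + k.+1 * 4 + 3).+1); last by lia.
  exact: e'_up.
- apply: walk_cycle (rail_walk k.+1 (isT : odd 3)) _.
  rewrite /e' /= -(lift_mod 3) (_ : 3 + n.+1 = (3 + k.+1 * 4 + 3).+1); last by lia.
  exact: e'_up.
- by lia.
- by lia.
- by rewrite card_prod !card_ord; lia.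
move=> u; have [j j_win <-] := lift_surj 1 u; rewrite mem_cat.
have in1 q : q <= k.+1 -> (lift (1 + q * 4) \in map lift (rail k.+1 1)) &&
    (lift (1 + q * 4 + 3) \in map lift (rail k.+1 1)).
  by move/(mem_rail 1)/andP=> [? ?]; rewrite !map_f.
have in3 q : q <= k.+1 -> (lift (3 + q * 4) \in map lift (rail k.+1 3)) &&
    (lift (3 + q * 4 + 3) \in map lift (rail k.+1 3)).
  by move/(mem_rail 3)/andP=> [? ?]; rewrite !map_f.
have [q [r [lt_r4 def_j]]] : exists q r, r < 4 /\ j = 1 + q * 4 + r.
  by exists ((j - 1) %/ 4), ((j - 1) %% 4); lia.
have le_qk : q <= k.+1 by lia.
case: r lt_r4 def_j => [|[|[|[|r]]]] // _ def_j.
- by rewrite def_j addn0; case/andP: (in1 q le_qk) => ->.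
(* Remainder 1 is the end of the preceding jump of the rail from 3; for [q = 0] that jump is the
   last one, which passes the seam. *)
- case: q le_qk def_j => [|q] le_qk def_j.
    rewrite def_j -lift_mod (_ : _ + n.+1 = 3 + k.+1 * 4 + 3); last by lia.
    by case/andP: (in3 _ (leqnn _)) => _ ->; rewrite orbT.
  rewrite def_j (_ : _ + 1 = 3 + q * 4 + 3); last by lia.
  by case/andP: (in3 q (ltnW le_qk)) => _ ->; rewrite orbT.
- rewrite def_j (_ : _ + 2 = 3 + q * 4); last by lia.
  by case/andP: (in3 q le_qk) => -> _; rewrite orbT.
by rewrite def_j; case/andP: (in1 q le_qk) => _ ->.
Qed.

Lemma cyclable_one_column : two_spanning_cyclable e.
Proof.
have sep4 u v : u \in map lift [:: 1; 2; 3; 4] -> v \notin map lift [:: 1; 2; 3; 4] ->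
    separated e u v.
  move=> u4 /negPf v4.
  exists (map lift [:: 1; 2; 3; 4]), (map lift [:: 5, 6 & ladder k 7]).
  split=> //; first exact: ladder_cover.
  by case: ladder_cover => _ _ _ _ /(_ v); rewrite mem_cat v4.
apply: (@two_spanning_cyclable_transitive _ _ (lift 1)).
- exact: htg_sym.
- exact: htg_transitive.
move=> v; have [j j_win <-] := lift_surj 1 v => neq_j1.
have lift_notin i : 4 < i <= n.+1 -> lift i \notin map lift [:: 1; 2; 3; 4].
  move=> i_range; rewrite !inE !negb_or.
  have neq_lift b : 0 < b < 5 -> lift i != lift b.
    move=> b_range; apply/eqP => /vtx_inj[] // _.
    rewrite [b %% _]modn_small; last by lia.
    by case: (ltngtP i n.+1) => [lt_in|lt_ni|->]; rewrite ?modnn ?modn_small //; lia.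
  by rewrite !neq_lift.
case: (leqP j 4) => [le_j4|lt_4j]; last first.
  by apply: sep4; [exact/map_f/mem_head | apply: lift_notin; lia].
have [def_j|def_j|def_j] : [\/ j = 2, j = 3 | j = 4].
- case: j neq_j1 j_win le_j4 => [|[|[|[|[|j]]]]]; rewrite ?eqxx // => _ _ _.
  + exact: Or31.
  + exact: Or32.
  + exact: Or33.
- exists (map lift (rail k.+1 1)), (map lift (rail k.+1 3)); split.
  + exact: rail_cover.
  + exact/map_f/mem_head.
  rewrite def_j -lift_mod (_ : _ + n.+1 = 3 + k.+1 * 4 + 3); last by lia.
  by apply: map_f; case/andP: (mem_rail 3 (leqnn k.+1)).
(* The shift takes level 1 to 3, on the 4-cycle, and levels 3 and 4 to 5 and 6, off it. *)
all: apply: (separated_aut_inv (@shift2_aut 0 n isT n_even)).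
all: rewrite !shift2E // def_j; apply: sep4; last by apply: lift_notin; lia.
all: exact: (map_f lift (x := 3)).
Qed.

End OneColumn.

(** * Neighbourhoods, forced edges and the excluded infinite families *)

Section Neighbours.
Variables m n : nat.
Hypotheses (n_even : ~~ odd n.+1) (n_gt1 : 1 < n).
Local Notation e := (@htg m.+1 n.+1 3).
Local Notation vtx := (@vtx m n).

(** The other end of the flat or jump edge at [vtx i j], which goes to the right when [i + j] is odd
    and to the left otherwise. Adding [n - 2] subtracts 3 modulo [n.+1]. *)
Definition horizontal i j :=
  if odd (i + j) then if i < m then vtx i.+1 j else vtx 0 (j + 3)
  else if 0 < i then vtx i.-1 j else vtx m (j + (n - 2)).

Lemma horizontal_mod i j j' : j = j' %[mod n.+1] -> horizontal i j = horizontal i j'.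
Proof.
move=> eq_j; have odd_j : odd j = odd j'.
  by rewrite -(odd_modn_even n_even j) eq_j odd_modn_even.
rewrite /horizontal !oddD odd_j; do 2!case: ifP => _; apply: eq_vtx => //.
  by rewrite -modnDml eq_j modnDml.
by rewrite -modnDml eq_j modnDml.
Qed.

Lemma htg_neighbours i j v : odd m.+1 -> i <= m -> e (vtx i j) v ->
  v \in [:: vtx i j.+1; vtx i (j + n); horizontal i j].
Proof.
move=> m_odd le_im /orP[] /(htg_arcP m_odd n_even)[i' [j' []]].
  move=> def_u def_v; have le_i' : i' <= m by case: def_v => [[]|[/ltnW]|[->]].
  have [def_i eq_j] := vtx_inj le_im le_i' def_u; subst i'.
  rewrite (horizontal_mod i eq_j) !inE.
  case: def_v => [[_ ->]|[lt_im odd_ij ->]|[def_i odd_j ->]].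
  - rewrite (@eq_vtx m n i j'.+1 j.+1) ?eqxx //.
    by apply/eqP; rewrite -(addn1 j) -(addn1 j') eqn_modDr eq_j.
  - by rewrite /horizontal odd_ij lt_im eqxx !orbT.
  by rewrite /horizontal def_i ltnn (_ : odd _) ?eqxx ?orbT //; lia.
move=> ->; case=> [[le_i' /vtx_inj[] // def_i eq_j]
  |[lt_i' odd_ij /vtx_inj[] // def_i eq_j]
   |[-> odd_j /vtx_inj[] // def_i eq_j]].
- subst i'; rewrite !inE (@eq_vtx m n i j' (j + n)) ?eqxx ?orbT //.
  by rewrite -[RHS]modnDml eq_j modnDml addSnnS modnDr.
- rewrite (horizontal_mod i eq_j) def_i /horizontal addSn /= odd_ij /=.
  by rewrite !inE eqxx !orbT.
rewrite (horizontal_mod i eq_j) def_i /horizontal add0n oddD odd_j /= !inE.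
rewrite (@eq_vtx m n m (j' + 3 + (n - 2)) j') ?eqxx ?orbT //.
by rewrite (_ : j' + 3 + (n - 2) = j' + n.+1) ?modnDr //; lia.
Qed.

End Neighbours.

Section TwoFactors.
Variables (T : finType) (e f : rel T).
Hypothesis f2 : two_factor e f.

(** Without [a], the two neighbours of [x] in [f] lie among [b] and [c], so both edges are
    forced. *)
Lemma two_factor_third a b c x : (forall y, e x y -> y \in [:: a; b; c]) ->
  ~~ f x a -> f x b && f x c.
Proof.
case: f2 => _ fe deg2 nbr_x fxa.
have sub_bc : [set y | f x y] \subset [set b; c].
  apply/subsetP=> y; rewrite !inE => fxy; have := nbr_x y (fe _ _ fxy).
  by rewrite !inE; case: eqP fxy fxa => //= -> ->.
have: [set y | f x y] == [set b; c].
  by rewrite eqEcard sub_bc deg2 cards2; case: (b != c).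
by move/eqP/setP=> eq_bc; move: (eq_bc b) (eq_bc c); rewrite !inE !eqxx orbT => -> ->.
Qed.

Lemma two_factor_pair a b x y : a != b -> f x a -> f x b -> f x y -> y \in [:: a; b].
Proof.
case: f2 => _ _ deg2 neq_ab fxa fxb fxy.
have: [set a; b] == [set y | f x y].
  rewrite eqEcard deg2 cards2 neq_ab leqnn andbT.
  by apply/subsetP=> z; rewrite !inE => /orP[]/eqP->.
by move/eqP/setP/(_ y); rewrite !inE fxy.
Qed.

Lemma two_factor_cycle c1 c2 : symmetric e -> consists_of_two_cycles f c1 c2 ->
  cycle e c1 /\ cycle e c2.
Proof.
case: f2 => _ fe _ e_sym [_ _ Uc fE]; move: Uc; rewrite cat_uniq => /and3P[U1 _ U2].
split; apply: cycle_from_next => // x xc; apply: fe; rewrite fE.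
  by rewrite /cycle_adj mem_next xc eqxx.
by rewrite orbC /cycle_adj mem_next xc eqxx.
Qed.

End TwoFactors.

Lemma not_cyclable_one_column n : odd (n.+1)./2 -> ~~ odd n.+1 -> 1 < n ->
  ~ two_spanning_cyclable (@htg 1 n.+1 3).
Proof.
move=> n_half n_even n_gt1; pose x j := @vtx 0 n 0 j.
have x_mod j : x (j + n.+1) = x j by apply: eq_vtx; rewrite modnDr.
have neq12 : x 1 != x 2.
  by apply/eqP => /vtx_inj[] // _; rewrite modn_small ?modn_small; lia.
case/(_ _ _ neq12) => f [c1 [c2 [f2 f_cyc x1 x2]]].
have chi j j' : f (x j) (x j') -> (x j \in c1) = (x j' \in c1).
  exact: two_cycles_invariant f_cyc.
have nbr_odd j : odd j -> forall y, htg 3 (x j) y ->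
    y \in [:: x j.+1; x (j + n); x (j + 3)].
  move=> odd_j y /(@htg_neighbours 0 n n_even n_gt1 _ _ _ isT (leqnn 0)).
  by rewrite /horizontal odd_j.
have nbr_even j : ~~ odd j -> forall y, htg 3 (x j) y ->
    y \in [:: x (j + n); x j.+1; x (j + (n - 2))].
  move=> odd_j y /(@htg_neighbours 0 n n_even n_gt1 _ _ _ isT (leqnn 0)).
  by rewrite /horizontal (negPf odd_j) !inE orbCA.
have x2' : x 2 \in c1 = false.
  case: f_cyc => _ _; rewrite cat_uniq => /and3P[_ /hasPn disj _] _.
  by apply/negbTE/disj.
(* The edge from [x (2k+1)] to [x (2k+2)] is absent from [f], so both its ends
   use their remaining edges, which forces the next such edge to be absent. *)
have alternate k : (x k.*2.+1 \in c1) = ~~ odd k /\ (x k.*2.+2 \in c1) = odd k.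
  elim: k => [|k [IH1 IH2]]; first by rewrite x1 x2'.
  have f_absent : ~~ f (x k.*2.+1) (x k.*2.+2).
    by apply/negP => /chi; rewrite IH1 IH2; case: (odd k).
  have odd_k : odd k.*2.+1 by rewrite /= odd_double.
  have even_k : ~~ odd k.*2.+2 by rewrite /= negbK odd_double.
  have /andP[_ /chi] := two_factor_third f2 (nbr_odd _ odd_k) f_absent.
  rewrite addn3 IH1 => eq_b; have f_absent' : ~~ f (x k.*2.+2) (x (k.*2.+2 + n)).
    by rewrite addSnnS x_mod; have [f_sym _ _] := f2; rewrite f_sym.
  have /andP[/chi] := two_factor_third f2 (nbr_even _ even_k) f_absent'.
  by rewrite IH2 doubleS => eq_w _; rewrite -eq_w -eq_b /= negbK.
(* Level [n.+2] is level 1 again, but an odd number of exchanges has put it outside [c1]. *)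
have [] := alternate (n.+1)./2.
by rewrite n_half even_halfK // (x_mod 1 : x n.+2 = _) x1.
Qed.

Lemma not_cyclable_four_rows m : odd m.+1 -> 1 < m ->
  ~ two_spanning_cyclable (@htg m.+1 4 3).
Proof.
move=> m_odd m_gt1; have m_gt0 := ltnW m_gt1; pose x i j := @vtx m 3 i j.
have neq_x i j j' : i <= m -> j < 4 -> j' < 4 -> j != j' -> x i j != x i j'.
  move=> le_im j4 j'4; apply: contraNneq => /vtx_inj[] // _.
  by rewrite !modn_small // => ->.
have neq_uv : x 0 1 != x 1 1 by apply/eqP => /vtx_inj[] //; lia.
case/(_ _ _ neq_uv) => f [c1 [c2 [f2 f_cyc u1 v2]]].
have [f_sym _ _] := f2.
have chi i j i' j' : f (x i j) (x i' j') -> (x i j \in c1) = (x i' j' \in c1).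
  exact: two_cycles_invariant f_cyc.
have v1 : x 1 1 \in c1 = false.
  case: f_cyc => _ _; rewrite cat_uniq => /and3P[_ /hasPn disj _] _.
  by apply/negbTE/disj.
have f_absent : ~~ f (x 0 1) (x 1 1) by apply/negP => /chi; rewrite u1 v1.
have x_mod i j : x i (j + 4) = x i j by apply: eq_vtx; rewrite modnDr.
have nbr i j : i < 2 -> odd j -> forall y, htg 3 (x i j) y ->
    y \in [:: x (1 - i) j; x i j.+1; x i (j + 3)].
  move=> lt_i2 odd_j y; have le_im : i <= m by apply: leq_trans m_gt0.
  move/(@htg_neighbours m 3 isT isT _ _ _ m_odd le_im).
  have -> : horizontal m 3 i j = x (1 - i) j.
    by case: i lt_i2 {le_im} => [|[|i]] // _; rewrite /horizontal /= odd_j ?m_gt0.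
  by rewrite !inE orbA orbC.
have vertical i j : i < 2 -> odd j -> ~~ f (x i j) (x (1 - i) j) ->
    f (x i j) (x i j.+1) && f (x i j) (x i (j + 3)).
  by move=> lt_i2 odd_j; apply: (two_factor_third f2); apply: nbr.
have absent1 i : i < 2 -> ~~ f (x i 1) (x (1 - i) 1).
  by case: i => [|[|i]] // _; rewrite f_sym.
(* Level 1 uses both its vertical edges, so levels 0 and 2 share its colour, and level 3 uses an
   edge to at least one of them. *)
have chi13 i : i < 2 -> (x i 3 \in c1) = (x i 1 \in c1).
  move=> lt_i2.
  have /andP[/chi eq12 /chi eq10] := vertical i 1 lt_i2 isT (absent1 i lt_i2).
  rewrite (x_mod i 0) in eq10.
  have [f32 | f32] := boolP (f (x i 3) (x i 2)).
    by rewrite (chi _ _ _ _ f32) eq12.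
  have nbr3 y : htg 3 (x i 3) y -> y \in [:: x i 2; x i 0; x (1 - i) 3].
    move/(nbr i 3 lt_i2 isT); rewrite (x_mod i 0) (x_mod i 2) !inE.
    by case/or3P=> ->; rewrite ?orbT.
  by case/andP: (two_factor_third f2 nbr3 f32) => /chi -> _.
have [/chi | absent3] := boolP (f (x 0 3) (x 1 3)); first by rewrite !chi13 // u1 v1.
have absent i j : i < 2 -> (j == 1) || (j == 3) -> ~~ f (x i j) (x (1 - i) j).
  by case: i => [|[|i]] // _ /orP[]/eqP->; rewrite // f_sym.
(* Both odd levels use both their vertical edges. These four edges form a 4-cycle and exhaust the
   valencies in column [i]. *)
have closed i : i < 2 -> forall u v, f u v -> (u.1 : nat) == i -> (v.1 : nat) == i.
  move=> lt_i2; have le_im : i <= m by apply: leq_trans m_gt0.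
  have [f12 f10] := andP (vertical i 1 lt_i2 isT (absent i 1 lt_i2 isT)).
  have [f30 f32] := andP (vertical i 3 lt_i2 isT (absent i 3 lt_i2 isT)).
  rewrite (x_mod i 0) in f10; rewrite (x_mod i 0) in f30; rewrite (x_mod i 2) in f32.
  have pair j k j' v : k < 4 -> j' < 4 -> k != j' ->
      f (x i j) (x i k) -> f (x i j) (x i j') -> f (x i j) v -> (v.1 : nat) == i.
    move=> k4 j'4 neq fk fj'.
    move/(two_factor_pair f2 (neq_x i k j' le_im k4 j'4 neq) fk fj').
    by rewrite !inE => /orP[]/eqP->; rewrite vtx1K.
  move=> u v fuv /eqP def_i; move: fuv.
  rewrite -(vtxK u) def_i; case: (nat_of_ord u.2) (ltn_ord u.2) => [|[|[|[|j]]]] // _.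
  - by apply: (pair 0 1 3) => //; rewrite f_sym.
  - exact: (pair 1 2 0).
  - by apply: (pair 2 1 3) => //; rewrite f_sym.
  exact: (pair 3 0 2).
(* Columns 0 and 1 would be all of the graph, yet [x 2 0] lies in neither. *)
have := two_cycles_closed f_cyc u1 v2 _ _ (closed 0 isT) (closed 1 isT)
  (two_cycles_mem (x 2 0) f2 f_cyc).
by rewrite !vtx1K // => /(_ isT isT).
Qed.

(** Two disjoint cycles need six vertices; this excludes HTG(1,4,3). *)
Lemma not_cyclable_small (T : finType) (e : rel T) (u v : T) :
  u != v -> #|T| < 6 -> ~ two_spanning_cyclable e.
Proof.
move=> neq_uv cardT /(_ u v neq_uv)[f [c1 [c2 [_ [sz1 sz2 Uc _] _ _]]]].
have := max_card (mem (c1 ++ c2)); rewrite (card_uniqP Uc) size_cat; lia.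
Qed.

(** * Exhaustive search in HTG(3,6,3) *)

Section CycleSearch.
Variables (T : eqType) (nb : T -> seq T).
Local Notation adj := (fun a b => b \in nb a).

(* Can a path ending in [x] be continued inside [rest] to a cycle through its
   origin [z], so that the unused part of [rest] satisfies [K]? *)
Fixpoint search z fuel (K : seq T -> bool) x rest : bool :=
  if fuel is fuel'.+1 then
    (if z \in nb x then K rest else false) ||
    has (fun y => if y \in rest then search z fuel' K y (rem y rest) else false)
        (nb x)
  else false.

(** The search can follow [p] step by step. Deleting vertices keeps [rest] equal to [p ++ q] only up
    to permutation, whence the form of the condition on [K]. Completeness suffices, as the search
    serves only to refute. *)
Lemma search_complete z fuel (K : seq T -> bool) x p q rest : size p < fuel ->
  path adj x p -> z \in nb (last x p) ->
  perm_eq rest (p ++ q) -> (forall q', perm_eq q' q -> K q') ->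
  search z fuel K x rest.
Proof.
elim: fuel x p rest => // fuel IHf x [|y p] rest /=.
  by move=> _ _ -> rest_q K_q; rewrite K_q.
rewrite ltnS => sz_p /andP[xy path_p] z_last rest_ypq K_q.
apply/orP; right; apply/hasP; exists y => //.
have y_rest : y \in rest by rewrite (perm_mem rest_ypq) mem_head.
rewrite y_rest; apply: IHf path_p z_last _ K_q => //.
by rewrite -(perm_cons y); apply: perm_trans rest_ypq; rewrite perm_sym perm_to_rem.
Qed.

(* The bounds on [size q] make both cycles have at least three vertices. *)
Definition search_two fuel u v rest :=
  search u fuel (fun q => if 1 < size q < (size rest).-1
                          then search v fuel (@nilp T) v q else false) u rest.

Lemma search_two_complete fuel u v p1 p2 rest : size rest <= fuel ->
  1 < size p1 -> 1 < size p2 ->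
  path adj u p1 -> u \in nb (last u p1) -> path adj v p2 -> v \in nb (last v p2) ->
  perm_eq rest (p1 ++ p2) -> search_two fuel u v rest.
Proof.
move=> sz_rest sz1 sz2 path1 last1 path2 last2 rest_p.
have := perm_size rest_p; rewrite size_cat => sz_p.
apply: search_complete path1 last1 rest_p _; first by lia.
move=> q' q'_p2; rewrite (perm_size q'_p2) ifT; last by lia.
apply: search_complete path2 last2 (_ : perm_eq q' (p2 ++ [::])) _; first by lia.
  by rewrite cats0.
by move=> r /perm_size/eqP.
Qed.

End CycleSearch.

(** Plain numbers below 18 replace pairs of ordinals, so that the search computes. *)
Definition code (u : 'I_3 * 'I_6) : nat := u.1 * 6 + u.2.

Definition code_neighbours (a : nat) : seq nat :=
  nth [::] [:: [:: 1; 5; 15]; [:: 2; 0; 7]; [:: 3; 1; 17]; [:: 4; 2; 9];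
     [:: 5; 3; 13]; [:: 0; 4; 11]; [:: 7; 11; 12]; [:: 8; 6; 1]; [:: 9; 7; 14];
     [:: 10; 8; 3]; [:: 11; 9; 16]; [:: 6; 10; 5]; [:: 13; 17; 6]; [:: 14; 12; 4];
     [:: 15; 13; 8]; [:: 16; 14; 0]; [:: 17; 15; 10]; [:: 12; 16; 2]] a.

Lemma code_neighboursP u v : htg 3 u v -> code v \in code_neighbours (code u).
Proof.
rewrite -(vtxK u); move/(@htg_neighbours 2 5 isT isT _ _ _ isT (fst_le u)).
have code_vtx i j : i <= 2 -> code (vtx 2 5 i j) = i * 6 + j %% 6.
  by move=> le_i2; rewrite /code vtx1K // vtx2K.
rewrite code_vtx ?fst_le //.
case: (nat_of_ord u.1) (fst_le u) => [|[|[|i]]] // _;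
  case: (nat_of_ord u.2) (ltn_ord u.2) => [|[|[|[|[|[|j]]]]]] // _;
  by rewrite !inE => /or3P[]/eqP->; rewrite code_vtx.
Qed.

Lemma code_lt u : code u < 18.
Proof.
case: u => i j; rewrite /code /=; have := ltn_ord i; have := ltn_ord j; lia.
Qed.

Lemma code_surj a : a < 18 -> exists u, a = code u.
Proof.
move=> lt_a; exists (vtx 2 5 (a %/ 6) (a %% 6)).
by rewrite /code vtx1K ?vtx2K; lia.
Qed.

Lemma code_inj : injective code.
Proof.
move=> [i j] [i' j']; rewrite /code /= => eq_c; have := ltn_ord j; have := ltn_ord j'.
by move=> lt_j' lt_j; congr pair; apply: val_inj => /=; lia.
Qed.

(** Rotating [c] to start at [u] puts it in the form expected by the search. *)
Lemma code_cycle c u : u \in c -> cycle (htg 3) c -> exists p,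
  [/\ perm_eq (map code c) (code u :: p),
      path (fun a b => b \in code_neighbours a) (code u) p
    & code u \in code_neighbours (last (code u) p)].
Proof.
move=> uc; have [i p def_c] := rot_to uc.
rewrite -(rot_cycle i) def_c /= rcons_path => /andP[path_p last_p].
exists (map code p); split; last by rewrite last_map code_neighboursP.
  by rewrite -(map_cons code) -def_c perm_map // perm_sym perm_rot.
rewrite path_map; apply: sub_path path_p => a b; exact: code_neighboursP.
Qed.

(** The roots 1 and 2 are the ends of a vertical edge, and 16 counts the other vertices. The
    conditionals in [search], used instead of conjunctions, spare [vm_compute] the discarded
    branches. *)
Lemma code_search : search_two code_neighbours 16 1 2 (0 :: iota 3 15) = false.
Proof. by vm_compute. Qed.

Lemma not_cyclable_pappus : ~ two_spanning_cyclable (@htg 3 6 3).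
Proof.
have neq_uv : vtx 2 5 0 1 != vtx 2 5 0 2 by apply/eqP => /vtx_inj[].
case/(_ _ _ neq_uv) => f [c1 [c2 [f2 f_cyc u1 v2]]].
have [ec1 ec2] := two_factor_cycle f2 (htg_sym 3) f_cyc.
have [sz1 sz2 Uc _] := f_cyc; have cov x := two_cycles_mem x f2 f_cyc.
have [p1 [perm1 path1 last1]] := code_cycle u1 ec1.
have [p2 [perm2 path2 last2]] := code_cycle v2 ec2.
have code_u : code (vtx 2 5 0 1) = 1 by rewrite /code vtx1K // vtx2K.
have code_v : code (vtx 2 5 0 2) = 2 by rewrite /code vtx1K // vtx2K.
rewrite code_u in perm1 path1 last1; rewrite code_v in perm2 path2 last2.
have perm_all : perm_eq (iota 0 18) ((1 :: p1) ++ (2 :: p2)).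
  apply: (@perm_trans _ (map code (c1 ++ c2))); last first.
    by rewrite map_cat (perm_cat perm1 perm2).
  apply: uniq_perm; rewrite ?iota_uniq ?(map_inj_uniq code_inj) // => a.
  rewrite mem_iota; apply/idP/mapP => [lt_a | [w _ ->]]; last exact: code_lt.
  by have [w ->] := code_surj lt_a; exists w.
have sz_p1 : 1 < size p1.
  by have := perm_size perm1; rewrite size_map /=; case: (size c1) sz1 => // k ? [<-].
have sz_p2 : 1 < size p2.
  by have := perm_size perm2; rewrite size_map /=; case: (size c2) sz2 => // k ? [<-].
have := code_search.
rewrite (search_two_complete _ sz_p1 sz_p2 path1 last1 path2 last2) //.
rewrite -(perm_cons 2) -(perm_cons 1).
apply: (@perm_trans _ (iota 0 18)) => //.
apply: (perm_trans perm_all); rewrite /= perm_cons.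
by rewrite -cat1s perm_catCA.
Qed.

(** * Distribution of the values of [m] and [n] among the cases *)

Theorem theorem4p2 (m n : nat) (m_ge1 : 1 <= m) (m_odd : odd m)
    (n_ge4 : 4 <= n) (n_even : ~~ odd n) :
  two_spanning_cyclable (@htg m n 3) <->
  [\/ [/\ m = 1, n = 0 %[mod 4] & 6 < n],
      (5 <= m) /\ (n = 6)
    | (3 <= m) /\ (8 <= n)].
Proof.
split=> [cyc|].
  have [m1|m_neq1] := eqVneq m 1.
    subst m; apply: Or31; case: n n_ge4 n_even cyc => // n n_ge4 n_even cyc.
    (* An odd half means 2 modulo 4; among the multiples of 4 only four levels remain to be
       excluded. *)
    case: (boolP (odd (n.+1)./2)) => [n_half|n_half].
      by case: (not_cyclable_one_column n_half n_even _ cyc); lia.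
    have [n3|n_neq3] := eqVneq n 3; last by split=> //; lia.
    subst n; case: (@not_cyclable_small _ (@htg 1 4 3)
      (vtx 0 3 0 0) (vtx 0 3 0 1)) => //.
      by apply/eqP => /vtx_inj[].
    by rewrite card_prod !card_ord.
  have m_ge3 : 3 <= m by lia.
  have [n_ge8|n_lt8] := leqP 8 n; first exact: Or33.
  have [n4|n6] : n = 4 \/ n = 6 by lia.
    subst n; case: m m_ge1 m_odd m_neq1 m_ge3 cyc => // m _ m_odd _ m_ge3.
    by move/(not_cyclable_four_rows m_odd m_ge3).
  have [m3|m_neq3] := eqVneq m 3; last by apply: Or32; lia.
  by subst m n; case: (not_cyclable_pappus cyc).
(* This serves both (ii) and the part of (iii) with [m >= 5]. *)
have five_columns : 5 <= m -> 6 <= n -> two_spanning_cyclable (@htg m n 3).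
  case: n n_even {n_ge4} => // n n_even m_ge5 n_ge6.
  have -> : m = ((m - 5)./2).*2 + 4 + 1 by lia.
  by rewrite addn1; apply: cyclable_five_columns.
case=> [[-> n_mod4 n_gt6]|[m_ge5 n6]|[m_ge3 n_ge8]].
- have -> : n = (n - 8) %/ 4 * 4 + 7 + 1 by lia.
  by rewrite addn1; apply: cyclable_one_column.
- by apply: five_columns; rewrite ?n6.
have [m3|m_neq3] := eqVneq m 3; last by apply: five_columns; lia.
have -> : n = ((n - 8)./2).*2 + 4 + 4 by lia.
by rewrite m3 [_ + 4]addn4; apply: cyclable_three_columns.
Qed.
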